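(* Let $(G,v)$ be a $\mathbb{T}^{(\infty,0)}$-algebra (a weak $\infty$-groupoid) of dimension $2$, and let $f:a\to b$ be a $1$-cell of $G$ (i.e. $f\in G(1)$ with $s^1_0(f)=a$, $t^1_0(f)=b$). Then $f$ is an equivalence.
   Context: **$\infty$-graphs.** An $\infty$-graph (globular set) $X$ consists of sets $X(m)=X_m$ ($m\in\mathbb{N}$), whose elements are called $m$-cells, and maps $s^{m+1}_m,t^{m+1}_m:X(m+1)\to X(m)$ with $s^{m}_{m-1}s^{m+1}_m=s^{m}_{m-1}t^{m+1}_m$ and $t^{m}_{m-1}t^{m+1}_m=t^{m}_{m-1}s^{m+1}_m$. For $p<m$, $s^m_p$ and $t^m_p$ denote the iterated sources and targets. Morphisms are maps commuting with sources and targets; the category is $\infty\text{-}\mathbb{G}\mathrm{r}$. **Reflexive $\infty$-graphs.** An $\infty$-graph with maps (reflexors) $1^m_{m+1}:X(m)\to X(m+1)$ with $s^{m+1}_m1^m_{m+1}=t^{m+1}_m1^m_{m+1}=\mathrm{id}$; put $1^p_m=1^{m-1}_m\circ\cdots\circ 1^p_{p+1}$ for $p<m$. A $q$-cell ($q\ge1$) is an identity cell if it lies in the image of $1^{q-1}_q$. A reflexive $\infty$-graph has dimension $p$ if all its $q$-cells with $q>p$ are identity cells and at least one $p$-cell is not an identity cell. **$(\infty,n)$-reversible structure** on an $\infty$-graph $X$: maps (reversors) $j^m_p:X_m\to X_m$ for $n\le p<m$ such that $s^{p+1}_pj^{p+1}_p=t^{p+1}_p$, $t^{p+1}_pj^{p+1}_p=s^{p+1}_p$,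 and for $m\ge p+2$, $s^m_{m-1}j^m_p=j^{m-1}_ps^m_{m-1}$ and $t^m_{m-1}j^m_p=j^{m-1}_pt^m_{m-1}$. **$\infty$-magmas.** A reflexive $\infty$-graph $M$ with composition maps $\circ^m_p$ ($0\le p<m$) sending each pair $(y,x)\in M(m)\times M(m)$ with $s^m_p(y)=t^m_p(x)$ to $y\circ^m_px\in M(m)$, subject only to the positional axioms: for $p<q<m$, $s^m_q(y\circ^m_px)=s^m_q(y)\circ^q_ps^m_q(x)$ and $t^m_q(y\circ^m_px)=t^m_q(y)\circ^q_pt^m_q(x)$; for $q\le p$, $s^m_q(y\circ^m_px)=s^m_q(x)$ and $t^m_q(y\circ^m_px)=t^m_q(y)$. Morphisms preserve reflexors and compositions. An $(\infty,n)$-magma is an $\infty$-magma whose underlying $\infty$-graph is equipped with an $(\infty,n)$-reversible structure (no compatibility with the reflexors or compositions is required); morphisms are morphisms of $\infty$-magmas that also commute with the reversors. **Strict $(\infty,n)$-categories.** A strict $\infty$-category is an $\infty$-magma in which the compositions are associative, unital ($x\circ^m_p1^p_m(s^m_p(x))=x=1^p_m(t^m_p(x))\circ^m_px$), satisfy the interchange laws, and $1^p_m(y\circ^p_qx)=1^p_m(y)\circ^m_q1^p_m(x)$ for $q<p<m$. A strict $(\infty,n)$-category is a strict $\infty$-category in which, for all $n\le p<m$, every $m$-cell $\alpha$ has a $\circ^m_p$-inverse $\beta$: $\alpha\circ^m_p\beta=1^p_m(t^m_p(\alpha))$ and $\beta\circ^m_p\alpha=1^p_m(s^m_p(\alpha))$.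 The inverse is unique, and $j^m_p(\alpha):=\beta$ makes every strict $(\infty,n)$-category an $(\infty,n)$-magma. Morphisms are strict $\infty$-functors. **$(\infty,n)$-categorical stretchings.** A tuple $(M,C,\pi,([-,-]_m)_{m\in\mathbb{N}})$ with $M$ an $(\infty,n)$-magma, $C$ a strict $(\infty,n)$-category, $\pi:M\to C$ a morphism of $(\infty,n)$-magmas, and maps $[-,-]_m:\widetilde M_m\to M_{m+1}$, where $\widetilde M_m=\{(c_1,c_0)\in M_m\times M_m: c_1\|c_0,\ \pi_m(c_1)=\pi_m(c_0)\}$, such that $t^{m+1}_m([c_1,c_0]_m)=c_1$, $s^{m+1}_m([c_1,c_0]_m)=c_0$, $\pi_{m+1}([c_1,c_0]_m)=1^m_{m+1}(\pi_m(c_1))=1^m_{m+1}(\pi_m(c_0))$, and $[c,c]_m=1^m_{m+1}(c)$. Here for $m\ge1$, $c_1\|c_0$ means that $c_1$ and $c_0$ have the same $s^m_{m-1}$ and the same $t^m_{m-1}$; any two $0$-cells are parallel. A morphism $(M,C,\pi,[-,-])\to(M',C',\pi',[-,-]')$ is a pair $(f,c)$ of a morphism of $(\infty,n)$-magmas $f:M\to M'$ and a strict $\infty$-functor $c:C\to C'$ with $\pi'f=c\pi$ and $f_{m+1}([c_1,c_0]_m)=[f_m(c_1),f_m(c_0)]'_m$. The category is $(\infty,n)\text{-}\mathbb{E}\mathrm{t}\mathbb{C}\mathrm{at}$. **The monad.** The forgetful functor $U_n:(\infty,n)\text{-}\mathbb{E}\mathrm{t}\mathbb{C}\mathrm{at}\to\infty\text{-}\mathbb{G}\mathrm{r}$,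 $(M,C,\pi,[-,-])\mapsto M$, has a left adjoint $F_n$. The induced monad on $\infty\text{-}\mathbb{G}\mathrm{r}$ is $\mathbb{T}^{(\infty,n)}=(T^n,\mu^n,\lambda^n)$. A weak $(\infty,n)$-category is a $\mathbb{T}^{(\infty,n)}$-algebra $(G,v)$, $v:T^n(G)\to G$; for $n=0$ it is called a weak $\infty$-groupoid. **Operations on an algebra.** $T^n(G)$ is the underlying $\infty$-graph of the free $(\infty,n)$-magma part $M^n(G)$ of $F_n(G)$; write $\star^m_p$, $1^p_m$, $j^m_p$ for the compositions, reflexors and reversors of $M^n(G)$. On a $\mathbb{T}^{(\infty,n)}$-algebra $(G,v)$ put $a\circ^m_pb:=v_m(\lambda^n_G(a)\star^m_p\lambda^n_G(b))$ when $s^m_p(a)=t^m_p(b)$; $\iota^p_m(a):=v_m(1^p_m(\lambda^n_G(a)))$ for $a\in G(p)$, $p<m$; $i^m_p(a):=v_m(j^m_p(\lambda^n_G(a)))$ for $a\in G(m)$, $n\le p<m$. The algebra $(G,v)$ has dimension $p$ if $G$, as a reflexive $\infty$-graph with reflexors $\iota^p_m$, has dimension $p$. **Isomorphisms and equivalences.** A $2$-cell $\alpha$ of $G$ is a $\circ^2_1$-isomorphism if there is a $2$-cell $\beta$ of $G$ with $\alpha\circ^2_1\beta=\iota^1_2(t^2_1(\alpha))$ and $\beta\circ^2_1\alpha=\iota^1_2(s^2_1(\alpha))$. A $1$-cell $f:a\to b$ of $G$ is an equivalence if there exist a $1$-cell $g:b\to a$ and $2$-cells $g\circ^1_0f\Rightarrow\iota^0_1(a)$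 and $f\circ^1_0g\Rightarrow\iota^0_1(b)$ of $G$ which are both $\circ^2_1$-isomorphisms. *)

(* Defs.v *)
From mathcomp Require Import all_boot.
From Stdlib Require Import ProofIrrelevance FunctionalExtensionality ClassicalEpsilon.
Set Implicit Arguments.
Unset Strict Implicit.
Unset Printing Implicit Defensive.

(* Sets are types with Leibniz equality. A partial operation takes a proof that
   its arguments lie in its domain; by proof irrelevance its value does not
   depend on that proof. *)

Record category := Category {
  obj :> Type;
  hom : obj -> obj -> Type;
  idc : forall a, hom a a;
  compc : forall a b c, hom b c -> hom a b -> hom a c;
  compc1 : forall a b (f : hom a b), compc f (idc a) = f;
  comp1c : forall a b (f : hom a b), compc (idc b) f = f;
  compcA : forall a b c d (h : hom c d) (g : hom b c) (f : hom a b),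
    compc h (compc g f) = compc (compc h g) f }.
Arguments hom {_} _ _.
Arguments idc {_} a.
Notation "g \oc f" := (compc g f) (at level 50, left associativity).

Record functor (A B : category) := Functor {
  fobj :> A -> B;
  fmap : forall a b, hom a b -> hom (fobj a) (fobj b);
  fmap1 : forall a, fmap (idc a) = idc (fobj a);
  fmapM : forall a b c (g : hom b c) (f : hom a b),
    fmap (g \oc f) = fmap g \oc fmap f }.
Arguments fmap {A B} F {a b} f : rename.

Record adjunction (A B : category) (F : functor A B) (U : functor B A) :=
  Adjunction {
  adj_unit : forall a, hom a (U (F a));
  adj_counit : forall b, hom (F (U b)) b;
  adj_unit_nat : forall a a' (f : hom a a'),
    adj_unit a' \oc f = fmap U (fmap F f) \oc adj_unit a;
  adj_counit_nat : forall b b' (g : hom b b'),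
    adj_counit b' \oc fmap F (fmap U g) = g \oc adj_counit b;
  adj_triangleF : forall a,
    adj_counit (F a) \oc fmap F (adj_unit a) = idc (F a);
  adj_triangleU : forall b,
    fmap U (adj_counit b) \oc adj_unit (U b) = idc (U b) }.

Record monad (A : category) := Monad {
  mon_T :> functor A A;
  mon_mult : forall a, hom (mon_T (mon_T a)) (mon_T a);
  mon_unit : forall a, hom a (mon_T a);
  mon_mult_nat : forall a b (f : hom a b),
    mon_mult b \oc fmap mon_T (fmap mon_T f) = fmap mon_T f \oc mon_mult a;
  mon_unit_nat : forall a b (f : hom a b),
    mon_unit b \oc f = fmap mon_T f \oc mon_unit a;
  mon_unitl : forall a, mon_mult a \oc mon_unit (mon_T a) = idc (mon_T a);
  mon_unitr : forall a, mon_mult a \oc fmap mon_T (mon_unit a) = idc (mon_T a);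
  mon_multA : forall a,
    mon_mult a \oc mon_mult (mon_T a) = mon_mult a \oc fmap mon_T (mon_mult a) }.

Record algebra (A : category) (T : monad A) := Algebra {
  alg_obj : A;
  alg_act : hom (T alg_obj) alg_obj;
  alg_unit : alg_act \oc mon_unit T alg_obj = idc alg_obj;
  alg_mult : alg_act \oc mon_mult T alg_obj = alg_act \oc fmap T alg_act }.

Definition comp_functor (A B C : category) (G : functor B C) (F : functor A B) :
  functor A C.
Proof.
refine {| fobj := fun a => G (F a); fmap := fun a b f => fmap G (fmap F f) |}.
- by move=> a; rewrite !fmap1.
- by move=> a b c g f; rewrite !fmapM.
Defined.

Definition adj_monad (A B : category) (F : functor A B) (U : functor B A)
  (adj : adjunction F U) : monad A.
Proof.
refine {| mon_T := comp_functor U F;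
          mon_mult := fun a => fmap U (adj_counit adj (F a));
          mon_unit := adj_unit adj |} => /=.
- by move=> a b f; rewrite -!fmapM adj_counit_nat.
- by move=> a b f; rewrite adj_unit_nat.
- by move=> a; rewrite adj_triangleU.
- by move=> a; rewrite -fmapM adj_triangleF fmap1.
- by move=> a; rewrite -!fmapM adj_counit_nat.
Defined.

(* [below p m] has exactly one element when [p < m] and none otherwise. Being
   in [Type], it allows iterated sources, targets and reflexors [X m -> X p]
   to be defined by recursion, without transport along equalities in [nat]. *)
Inductive below (p : nat) : nat -> Type :=
| below_S : below p p.+1
| below_SS m : below p m -> below p m.+1.
Arguments below_S p, {p}.
Arguments below_SS {p m} _.

Lemma below_ltn p m : below p m -> p < m.
Proof. by elim=> [|k _ IH] //; apply: leqW. Qed.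

Lemma ltn_below p m : p < m -> below p m.
Proof.
elim: m => // m IH; rewrite ltnS leq_eqVlt.
case: (p =P m) => [->|_] /= lt_pm; first exact: below_S.
exact/below_SS/IH.
Qed.

Lemma below_inv p m (h : below p m.+1) :
  (exists e : m = p, h = ecast k (below p k.+1) (esym e) (below_S p))
  \/ exists h', h = below_SS h'.
Proof.
refine (match h as h0 in below _ k return
  match k return below p k -> Prop with
  | 0 => fun _ => True
  | m'.+1 => fun h1 => (exists e : m' = p,
      h1 = ecast k (below p k.+1) (esym e) (below_S p))
      \/ exists h', h1 = below_SS h'
  end h0 with below_S => _ | below_SS m' h' => _ end).
- by left; exists erefl.
- by right; exists h'.
Qed.

Lemma below_unique p m (h h' : below p m) : h = h'.
Proof.
elim: h h' => [|k h IH] h'; case: (below_inv h') => [[e E]|[h1 ->]].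
- by rewrite E (eq_irrelevance e erefl).
- by have := below_ltn h1; rewrite ltnn.
- by exfalso; move: (below_ltn h); rewrite e ltnn.
- by rewrite (IH h1).
Qed.

Record graph := Graph {
  cell :> nat -> Type;
  src : forall m, cell m.+1 -> cell m;
  tgt : forall m, cell m.+1 -> cell m;
  src_tgt : forall m (x : cell m.+2), src (src x) = src (tgt x);
  tgt_src : forall m (x : cell m.+2), tgt (tgt x) = tgt (src x) }.
Arguments src {g m} x.
Arguments tgt {g m} x.

Fixpoint isrc (X : graph) p m (h : below p m) : X m -> X p :=
  match h in below _ m return X m -> X p with
  | below_S => @src X p
  | below_SS m' h' => fun x => isrc h' (src x)
  end.

Fixpoint itgt (X : graph) p m (h : below p m) : X m -> X p :=
  match h in below _ m return X m -> X p with
  | below_S => @tgt X p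
  | below_SS m' h' => fun x => itgt h' (tgt x)
  end.

Definition parallel (X : graph) m : X m -> X m -> Prop :=
  match m with
  | 0 => fun _ _ => True
  | m'.+1 => fun c1 c0 => src c1 = src c0 /\ tgt c1 = tgt c0
  end.

Record graph_hom (X Y : graph) := GraphHom {
  gfun :> forall m, X m -> Y m;
  gfun_src : forall m (x : X m.+1), gfun (src x) = src (gfun x);
  gfun_tgt : forall m (x : X m.+1), gfun (tgt x) = tgt (gfun x) }.
Arguments gfun {X Y} g {m} x.

Lemma isrc_hom X Y (f : graph_hom X Y) p m (h : below p m) (x : X m) :
  f p (isrc h x) = isrc h (f m x).
Proof. by elim: h x => [|k h IH] x /=; rewrite ?IH gfun_src. Qed.

Lemma itgt_hom X Y (f : graph_hom X Y) p m (h : below p m) (x : X m) :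
  f p (itgt h x) = itgt h (f m x).
Proof. by elim: h x => [|k h IH] x /=; rewrite ?IH gfun_tgt. Qed.

Lemma isrc_srctgt (X : graph) p m (h : below p m) (x : X m.+1) :
  isrc h (src x) = isrc h (tgt x).
Proof. by case: h x => [|k h] x /=; rewrite src_tgt. Qed.

Lemma itgt_srctgt (X : graph) p m (h : below p m) (x : X m.+1) :
  itgt h (src x) = itgt h (tgt x).
Proof. by case: h x => [|k h] x /=; rewrite tgt_src. Qed.

Lemma graph_hom_eq X Y (f g : graph_hom X Y) :
  (forall m (x : X m), f m x = g m x) -> f = g.
Proof.
case: f g => [f fs ft] [g gs gt] /= E.
have E' : f = g.
  by apply: functional_extensionality_dep => m;
     apply: functional_extensionality_dep => x; apply: E.
by subst g; rewrite (proof_irrelevance _ fs gs) (proof_irrelevance _ ft gt).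
Qed.

Definition graph_id X : graph_hom X X := @GraphHom X X (fun m x => x)
  (fun _ _ => erefl) (fun _ _ => erefl).

Definition graph_comp X Y Z (g : graph_hom Y Z) (f : graph_hom X Y) :
  graph_hom X Z.
Proof.
refine {| gfun := fun m x => g m (f m x) |}.
- by move=> m x; rewrite !gfun_src.
- by move=> m x; rewrite !gfun_tgt.
Defined.

Definition Gr : category.
Proof.
refine {| obj := graph; hom := graph_hom; idc := graph_id;
          compc := graph_comp |}; by move=> *; apply: graph_hom_eq.
Defined.

Record reflexors (X : graph) := Reflexors {
  rfl : forall m, X m -> X m.+1;
  src_rfl : forall m (x : X m), src (rfl x) = x;
  tgt_rfl : forall m (x : X m), tgt (rfl x) = x }.
Arguments rfl {X} r {m} x.

Fixpoint irfl (X : graph) (r : reflexors X) p m (h : below p m) : X p -> X m :=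
  match h in below _ m return X p -> X m with
  | below_S => @rfl X r p
  | below_SS m' h' => fun x => rfl r (irfl r h' x)
  end.

Definition is_identity (X : graph) (r : reflexors X) q : X q -> Prop :=
  match q with
  | 0 => fun _ => False
  | q'.+1 => fun c => exists c', c = rfl r c'
  end.

Definition has_dimension (X : graph) (r : reflexors X) (p : nat) : Prop :=
  (forall q (c : X q), p < q -> is_identity r c) /\
  (exists c : X p, ~ is_identity r c).

Record reversors (n : nat) (X : graph) := Reversors {
  rev : forall p m, n <= p -> below p m -> X m -> X m;
  src_rev_top : forall p (np : n <= p) (x : X p.+1),
    src (rev np below_S x) = tgt x;
  tgt_rev_top : forall p (np : n <= p) (x : X p.+1),
    tgt (rev np below_S x) = src x;
  src_rev : forall p m (np : n <= p) (h : below p m) (x : X m.+1),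
    src (rev np (below_SS h) x) = rev np h (src x);
  tgt_rev : forall p m (np : n <= p) (h : below p m) (x : X m.+1),
    tgt (rev np (below_SS h) x) = rev np h (tgt x) }.
Arguments rev {n X} r {p m} np h x.

Record magma := Magma {
  mgraph :> graph;
  mrfl : reflexors mgraph;
  comp : forall p m (h : below p m) (y x : mgraph m),
    isrc h y = itgt h x -> mgraph m;
  isrc_comp_gt : forall p q m (pq : below p q) (qm : below q m)
    (pm : below p m) (y x : mgraph m) e e',
    isrc qm (@comp p m pm y x e) = @comp p q pq (isrc qm y) (isrc qm x) e';
  itgt_comp_gt : forall p q m (pq : below p q) (qm : below q m)
    (pm : below p m) (y x : mgraph m) e e',
    itgt qm (@comp p m pm y x e) = @comp p q pq (itgt qm y) (itgt qm x) e';
  isrc_comp_le : forall q p m (qm : below q m) (pm : below p m)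
    (y x : mgraph m) e, q <= p -> isrc qm (@comp p m pm y x e) = isrc qm x;
  itgt_comp_le : forall q p m (qm : below q m) (pm : below p m)
    (y x : mgraph m) e, q <= p -> itgt qm (@comp p m pm y x e) = itgt qm y }.
Arguments mrfl : clear implicits.
Arguments comp {m p m0} h y x e : rename.

Record magma_hom (M N : magma) := MagmaHom {
  mfun :> graph_hom M N;
  mfun_rfl : forall m (x : M m), mfun m.+1 (rfl (mrfl M) x) = rfl (mrfl N) (mfun m x);
  mfun_comp : forall p m (h : below p m) (y x : M m) e e',
    mfun m (comp h y x e) = comp h (mfun m y) (mfun m x) e' }.

Record nmagma (n : nat) := NMagma {
  nmag :> magma;
  nrev : reversors n nmag }.
Arguments nrev {n} M : rename.

Record nmagma_hom n (M N : nmagma n) := NMagmaHom {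
  nfun :> magma_hom M N;
  nfun_rev : forall p m (np : n <= p) (h : below p m) (x : M m),
    nfun m (rev (nrev M) np h x) = rev (nrev N) np h (nfun m x) }.

Lemma magma_hom_eq M N (f g : magma_hom M N) :
  (forall m (x : M m), f m x = g m x) -> f = g.
Proof.
case: f g => [f f1 f2] [g g1 g2] /= /graph_hom_eq E; subst g.
by rewrite (proof_irrelevance _ f1 g1) (proof_irrelevance _ f2 g2).
Qed.

Lemma nmagma_hom_eq n (M N : nmagma n) (f g : nmagma_hom M N) :
  (forall m (x : M m), f m x = g m x) -> f = g.
Proof.
case: f g => [f f1] [g g1] /= /magma_hom_eq E; subst g.
by rewrite (proof_irrelevance _ f1 g1).
Qed.

Definition magma_id M : magma_hom M M.
Proof.
refine {| mfun := graph_id M |} => //=.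
by move=> p m h y x e e'; rewrite (proof_irrelevance _ e e').
Defined.

Lemma hom_composable X Y (f : graph_hom X Y) p m (h : below p m) (y x : X m) :
  isrc h y = itgt h x -> isrc h (f m y) = itgt h (f m x).
Proof. by move=> e; rewrite -isrc_hom -itgt_hom e. Qed.

Definition magma_comp M N P (g : magma_hom N P) (f : magma_hom M N) :
  magma_hom M P.
Proof.
refine {| mfun := graph_comp g f |} => /=.
- by move=> m x; rewrite !mfun_rfl.
- move=> p m h y x e e'.
  by rewrite (mfun_comp e (hom_composable f e)) (mfun_comp _ e').
Defined.

Definition nmagma_id n (M : nmagma n) : nmagma_hom M M.
Proof. by refine {| nfun := magma_id M |}. Defined.

Definition nmagma_comp n (M N P : nmagma n) (g : nmagma_hom N P)
  (f : nmagma_hom M N) : nmagma_hom M P.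
Proof.
refine {| nfun := magma_comp g f |} => p m np h x /=.
by rewrite !nfun_rev.
Defined.

(* In each equation between composites, composability of one side follows from
   that of the other. *)
Record is_strict (C : magma) : Prop := IsStrict {
  scompA : forall p m (h : below p m) (z y x : C m) e1 e2 e3 e4,
    comp h z (comp h y x e1) e2 = comp h (comp h z y e3) x e4;
  scompr1 : forall p m (h : below p m) (x : C m) e,
    comp h x (irfl (mrfl C) h (isrc h x)) e = x;
  scompl1 : forall p m (h : below p m) (x : C m) e,
    comp h (irfl (mrfl C) h (itgt h x)) x e = x;
  sinterchange : forall q p m (qp : below q p) (pm : below p m)
    (qm : below q m) (y' y x' x : C m) e1 e2 e3 e4 e5 e6,
    comp qm (comp pm y' y e1) (comp pm x' x e2) e3
    = comp pm (comp qm y' x' e4) (comp qm y x e5) e6;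
  sirfl_comp : forall q p m (qp : below q p) (pm : below p m)
    (qm : below q m) (y x : C p) e e',
    irfl (mrfl C) pm (comp qp y x e)
    = comp qm (irfl (mrfl C) pm y) (irfl (mrfl C) pm x) e' }.

Definition is_inverse (C : magma) p m (h : below p m) (a b : C m) : Prop :=
  exists (e : isrc h a = itgt h b) (e' : isrc h b = itgt h a),
    comp h a b e = irfl (mrfl C) h (itgt h a) /\
    comp h b a e' = irfl (mrfl C) h (isrc h a).

Record strict_ncat (n : nat) := StrictNCat {
  smag :> magma;
  smag_strict : is_strict smag;
  smag_inv : forall p m (h : below p m), n <= p ->
    forall a : smag m, exists b, is_inverse h a b }.

Lemma comp_congr (M : magma) p m (h : below p m) (y y' x x' : M m) e e' :
  y = y' -> x = x' -> comp h y x e = comp h y' x' e'.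
Proof. by move=> ? ?; subst; rewrite (proof_irrelevance _ e e'). Qed.

Lemma isrc_irfl (X : graph) (r : reflexors X) p m (h : below p m) (x : X p) :
  isrc h (irfl r h x) = x.
Proof. by elim: h => [|k h IH] /=; rewrite src_rfl. Qed.

Lemma itgt_irfl (X : graph) (r : reflexors X) p m (h : below p m) (x : X p) :
  itgt h (irfl r h x) = x.
Proof. by elim: h => [|k h IH] /=; rewrite tgt_rfl. Qed.

Lemma inverse_unique (C : magma) (sC : is_strict C) p m (h : below p m)
  (a b b' : C m) : is_inverse h a b -> is_inverse h a b' -> b = b'.
Proof.
move=> [e1 [e2 [ab ba]]] [e3 [e4 [ab' ba']]].
have e5 : isrc h b = itgt h (comp h a b' e3) by rewrite itgt_comp_le.
have e6 : isrc h (comp h b a e2) = itgt h b' by rewrite isrc_comp_le.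
have e7 : isrc h b = itgt h (irfl (mrfl C) h (isrc h b)) by rewrite itgt_irfl.
have e8 : isrc h (irfl (mrfl C) h (itgt h b')) = itgt h b' by rewrite isrc_irfl.
rewrite -{1}(scompr1 sC e7) -(scompl1 sC e8).
have -> : comp h b (irfl (mrfl C) h (isrc h b)) e7 = comp h b (comp h a b' e3) e5.
  by apply: comp_congr; rewrite ?ab' ?e2.
rewrite (scompA sC e5 e6).
by apply: comp_congr; rewrite ?ba ?e3.
Qed.

Definition strict_inv n (C : strict_ncat n) p m (np : n <= p) (h : below p m)
  (a : C m) : C m :=
  proj1_sig (constructive_indefinite_description _ (smag_inv h np a)).

Lemma strict_invP n (C : strict_ncat n) p m (np : n <= p) (h : below p m)
  (a : C m) : is_inverse h a (strict_inv np h a).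
Proof. exact: proj2_sig (constructive_indefinite_description _ _). Qed.

Lemma src_inverse (C : magma) p m (h : below p m) (a b : C m.+1) :
  is_inverse (below_SS h) a b -> is_inverse h (src a) (src b).
Proof.
move=> [e [e' [ab ba]]].
have f : isrc h (src a) = itgt h (src b) by rewrite itgt_srctgt.
have f' : isrc h (src b) = itgt h (src a) by rewrite itgt_srctgt.
exists f, f'; split.
- rewrite -(@isrc_comp_gt C p m m.+1 h below_S (below_SS h) a b e f) ab /=.
  by rewrite src_rfl itgt_srctgt.
- rewrite -(@isrc_comp_gt C p m m.+1 h below_S (below_SS h) b a e' f') ba /=.
  by rewrite src_rfl.
Qed.

Lemma tgt_inverse (C : magma) p m (h : below p m) (a b : C m.+1) :
  is_inverse (below_SS h) a b -> is_inverse h (tgt a) (tgt b).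
Proof.
move=> [e [e' [ab ba]]].
have f : isrc h (tgt a) = itgt h (tgt b) by rewrite -isrc_srctgt.
have f' : isrc h (tgt b) = itgt h (tgt a) by rewrite -isrc_srctgt.
exists f, f'; split.
- rewrite -(@itgt_comp_gt C p m m.+1 h below_S (below_SS h) a b e f) ab /=.
  by rewrite tgt_rfl.
- rewrite -(@itgt_comp_gt C p m m.+1 h below_S (below_SS h) b a e' f') ba /=.
  by rewrite tgt_rfl isrc_srctgt.
Qed.

Definition strict_reversors n (C : strict_ncat n) : reversors n C.
Proof.
refine {| rev := @strict_inv n C |}.
- by move=> p np x; case: (strict_invP np below_S x) => [_ [e' _]].
- by move=> p np x; case: (strict_invP np below_S x) => [e _].
- move=> p m np h x; apply: (inverse_unique (smag_strict C)).
    exact: src_inverse (strict_invP np (below_SS h) x).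
  exact: strict_invP.
- move=> p m np h x; apply: (inverse_unique (smag_strict C)).
    exact: tgt_inverse (strict_invP np (below_SS h) x).
  exact: strict_invP.
Defined.

Definition strict_nmagma n (C : strict_ncat n) : nmagma n :=
  NMagma (strict_reversors C).

Record stretching (n : nat) := Stretching {
  stM : nmagma n;
  stC : strict_ncat n;
  stpi : nmagma_hom stM (strict_nmagma stC);
  br : forall m (c1 c0 : stM m),
    parallel c1 c0 -> stpi m c1 = stpi m c0 -> stM m.+1;
  tgt_br : forall m (c1 c0 : stM m) par e, tgt (@br m c1 c0 par e) = c1;
  src_br : forall m (c1 c0 : stM m) par e, src (@br m c1 c0 par e) = c0;
  pi_br : forall m (c1 c0 : stM m) par e,
    stpi m.+1 (@br m c1 c0 par e) = rfl (mrfl stC) (stpi m c1) /\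
    stpi m.+1 (@br m c1 c0 par e) = rfl (mrfl stC) (stpi m c0);
  br_diag : forall m (c : stM m) par e, @br m c c par e = rfl (mrfl stM) c }.
Arguments br {n} s {m} c1 c0 par e.

Record stretching_hom n (S S' : stretching n) := StretchingHom {
  stf : nmagma_hom (stM S) (stM S');
  stc : magma_hom (stC S) (stC S');
  stpi_nat : forall m (x : stM S m), stpi S' m (stf m x) = stc m (stpi S m x);
  stf_br : forall m (c1 c0 : stM S m) par e par' e',
    stf m.+1 (br S c1 c0 par e) = br S' (stf m c1) (stf m c0) par' e' }.

Lemma stretching_hom_eq n (S S' : stretching n) (f g : stretching_hom S S') :
  (forall m (x : stM S m), stf f m x = stf g m x) ->
  (forall m (x : stC S m), stc f m x = stc g m x) -> f = g.
Proof.
case: f g => [f c f1 f2] [g d g1 g2] /= /nmagma_hom_eq E /magma_hom_eq E'.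
by subst g d; rewrite (proof_irrelevance _ f1 g1) (proof_irrelevance _ f2 g2).
Qed.

Definition stretching_id n (S : stretching n) : stretching_hom S S.
Proof.
refine {| stf := nmagma_id (stM S); stc := magma_id (stC S) |} => //=.
move=> m c1 c0 par e par' e'.
by rewrite (proof_irrelevance _ par par') (proof_irrelevance _ e e').
Defined.

Lemma parallel_hom X Y (f : graph_hom X Y) m (c1 c0 : X m) :
  parallel c1 c0 -> parallel (f m c1) (f m c0).
Proof.
case: m c1 c0 => //= m c1 c0 [es et].
by rewrite -!gfun_src -!gfun_tgt es et.
Qed.

Definition stretching_comp n (S S' S'' : stretching n)
  (g : stretching_hom S' S'') (f : stretching_hom S S') : stretching_hom S S''.
Proof.
refine {| stf := nmagma_comp (stf g) (stf f);
          stc := magma_comp (stc g) (stc f) |} => /=.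
- by move=> m x; rewrite !stpi_nat.
- move=> m c1 c0 par e par' e'.
  have par1 := parallel_hom (stf f) par.
  have e1 : stpi S' m (stf f m c1) = stpi S' m (stf f m c0).
    by rewrite !stpi_nat e.
  by rewrite (stf_br par e par1 e1) (stf_br par1 e1 par' e').
Defined.

Definition EtCat (n : nat) : category.
Proof.
refine {| obj := stretching n; hom := @stretching_hom n;
          idc := @stretching_id n; compc := @stretching_comp n |};
  by move=> *; apply: stretching_hom_eq.
Defined.

Definition forget (n : nat) : functor (EtCat n) Gr.
Proof.
refine (@Functor (EtCat n) Gr (fun S => stM S) (fun S S' f => stf f) _ _);
  by move=> *; apply: graph_hom_eq.
Defined.

(* The monad is determined by the forgetful functor only up to the choice of a
   left adjoint, so everything below takes a left adjoint as a parameter. *)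

Section WeakCategories.

Variables (n : nat) (F : functor Gr (EtCat n)) (adj : adjunction F (forget n)).

Definition weak_ncat := algebra (adj_monad adj).

Variable A : weak_ncat.

Definition wgraph : graph := alg_obj A.
Definition wfree : nmagma n := stM (F wgraph).
Definition wact : graph_hom wfree wgraph := alg_act A.
Definition wunit : graph_hom wgraph wfree := adj_unit adj wgraph.

Definition wcomp p m (h : below p m) (a b : wgraph m)
  (e : isrc h a = itgt h b) : wgraph m :=
  wact m (comp h (wunit m a) (wunit m b) (hom_composable wunit e)).
Arguments wcomp {p m} h a b e.

Definition wid p m (h : below p m) (a : wgraph p) : wgraph m :=
  wact m (irfl (mrfl wfree) h (wunit p a)).

Lemma wact_unit m (a : wgraph m) : wact m (wunit m a) = a.
Proof.
have E : graph_comp wact wunit = graph_id wgraph := alg_unit A.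
by rewrite -[LHS]/(gfun (graph_comp wact wunit) a) E.
Qed.

Definition wreflexors : reflexors wgraph.
Proof.
refine {| rfl := fun m => wid (below_S m) |} => m a; rewrite /wid /=.
- by rewrite -gfun_src src_rfl wact_unit.
- by rewrite -gfun_tgt tgt_rfl wact_unit.
Defined.

Lemma wact_rfl m (x : wfree m) :
  wact m.+1 (rfl (mrfl wfree) x) = rfl wreflexors (wact m x).
Proof.
pose Tv : stretching_hom (F (forget n (F wgraph))) (F wgraph) :=
  fmap F (alg_act A).
pose mu : stretching_hom (F (forget n (F wgraph))) (F wgraph) :=
  adj_counit adj (F wgraph).
pose la : graph_hom wfree (stM (F (forget n (F wgraph)))) :=
  adj_unit adj (forget n (F wgraph)).
have Emu k z : wact k (stf mu k z) = wact k (stf Tv k z).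
  have E : graph_comp wact (stf mu) = graph_comp wact (stf Tv) := alg_mult A.
  by rewrite -[LHS]/(gfun (graph_comp wact (stf mu)) z) E.
have Enat k z : wunit k (wact k z) = stf Tv k (la k z).
  have E : graph_comp wunit wact = graph_comp (stf Tv) la :=
    adj_unit_nat adj (alg_act A).
  by rewrite -[LHS]/(gfun (graph_comp wunit wact) z) E.
have Etri k z : stf mu k (la k z) = z.
  have E : graph_comp (stf mu) la = graph_id wfree :=
    adj_triangleU adj (F wgraph).
  by rewrite -[LHS]/(gfun (graph_comp (stf mu) la) z) E.
rewrite /= /wid /= Enat -mfun_rfl -Emu mfun_rfl.
by congr (wact _ (rfl _ _)); rewrite Etri.
Qed.

Lemma irfl_wreflexors p m (h : below p m) (a : wgraph p) :
  irfl wreflexors h a = wid h a.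
Proof.
elim: h => [|k h IH] //; rewrite -[LHS]/(rfl wreflexors (irfl wreflexors h a)).
by rewrite IH -wact_rfl.
Qed.

Definition wdimension (p : nat) : Prop := has_dimension wreflexors p.

Definition iso21 (alpha : wgraph 2) : Prop :=
  exists (beta : wgraph 2) (e : src alpha = tgt beta) (e' : src beta = tgt alpha),
    wcomp below_S alpha beta e = wid below_S (tgt alpha) /\
    wcomp below_S beta alpha e' = wid below_S (src alpha).

Definition is_equivalence (a b : wgraph 0) (f : wgraph 1) : Prop :=
  src f = a /\ tgt f = b /\
  exists g : wgraph 1, src g = b /\ tgt g = a /\
  exists (e : src g = tgt f) (e' : src f = tgt g) (alpha beta : wgraph 2),
    (src alpha = wcomp below_S g f e /\ tgt alpha = wid below_S a /\
     iso21 alpha) /\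
    (src beta = wcomp below_S f g e' /\ tgt beta = wid below_S b /\
     iso21 beta).

End WeakCategories.
Arguments wcomp {n F adj A p m} h a b e.

(* Main.v *)
Require Import Defs.
From mathcomp Require Import all_boot.
(* Restores [comp] and [rev] of magmas over those of functions and sequences. *)
Import Defs.

(** In the free stretching on [G], contractions provide a cell between any two
    parallel cells with the same image in the strict part.  Let [j] be the
    formal reversal of the generator [f].  The composites [j * f] and [f * j]
    become identities in the strict part, since there reversal is genuine
    inversion; so each of them is linked to the formal identity by a contraction
    2-cell.  The structure map [v] sends these 2-cells to the 2-cells required
    in [G], with [v j] as the weak inverse of [f]; this uses that [v] transports
    the operations of the free magma to those of [G] ([wact_comp]).

    To invert such a 2-cell, contract the same pair in the opposite order.  Both
    contractions lie over an identity, hence so do their two composites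
    ([stpi_comp_br]), and a further contraction, now a 3-cell, links each
    composite to a formal identity 2-cell.  In dimension 2 all 3-cells of [G]
    are identities, so [v] identifies the two ends of that 3-cell ([wact_eq]):
    the inversion laws, which hold in general only up to higher cells, become
    equations. *)

(** The image under [stpi] of the two opposite contractions is a pair of copies
    of one identity cell, whose composite is again that identity by unitality. *)
Lemma stpi_comp_br {n} {S : stretching n} {m} {x y : stM S m} par e par' e' E :
  stpi S m.+1 (comp below_S (br S x y par e) (br S y x par' e') E) =
  rfl (mrfl (stC S)) (stpi S m x).
Proof.
rewrite (mfun_comp E (hom_composable (stpi S) E)).
have [_ pi_xy] := pi_br par e; have [pi_yx _] := pi_br par' e'.
have E1 : isrc below_S (rfl (mrfl (stC S)) (stpi S m y)) =
    itgt below_S (irfl (mrfl (stC S)) below_S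
      (isrc below_S (rfl (mrfl (stC S)) (stpi S m y)))).
  by rewrite itgt_irfl.
rewrite e -[RHS](scompr1 (smag_strict (stC S)) E1).
by apply: comp_congr; rewrite ?pi_xy ?pi_yx //= src_rfl.
Qed.

(** [stpi] commutes with reversors, and those of a strict category are its
    inverses. *)
Lemma stpi_comp_rev {n} {S : stretching n} {p m} (np : n <= p) (h : below p m)
    (x : stM S m) :
  (forall E, stpi S m (comp h (rev (nrev (stM S)) np h x) x E) =
     irfl (mrfl (stC S)) h (isrc h (stpi S m x))) /\
  (forall E, stpi S m (comp h x (rev (nrev (stM S)) np h x) E) =
     irfl (mrfl (stC S)) h (itgt h (stpi S m x))).
Proof.
have [e [e' [ab ba]]] := strict_invP np h (stpi S m x).
split=> E; rewrite (mfun_comp E (hom_composable (stpi S) E)) -?ab -?ba;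
  by apply: comp_congr => //; rewrite nfun_rev.
Qed.

Section Algebra.

Context {n : nat} {F : functor Gr (EtCat n)} {adj : adjunction F (forget n)}.
Context {A : weak_ncat adj}.

(** Both sides are images under [v] of one composite in the free stretching on
    the underlying graph of the free stretching on [G], flattened by the
    multiplication on one side and evaluated by the functorial action of [v] on
    the other.  The two agree by the associativity axiom of an algebra, because
    both maps, being morphisms of stretchings, preserve composites. *)
Lemma wact_comp {p m} {h : below p m} {y x : wfree A m} e e' :
  wact A m (comp h y x e) = wcomp h (wact A m y) (wact A m x) e'.
Proof.
pose Tv : stretching_hom (F (forget n (F (wgraph A)))) (F (wgraph A)) :=
  fmap F (alg_act A).
pose mu : stretching_hom (F (forget n (F (wgraph A)))) (F (wgraph A)) :=
  adj_counit adj (F (wgraph A)).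
pose la : graph_hom (wfree A) (stM (F (forget n (F (wgraph A))))) :=
  adj_unit adj (forget n (F (wgraph A))).
have Emu k z : wact A k (stf mu k z) = wact A k (stf Tv k z).
  have E : graph_comp (wact A) (stf mu) = graph_comp (wact A) (stf Tv) :=
    alg_mult A.
  by rewrite -[LHS]/(gfun (graph_comp (wact A) (stf mu)) z) E.
have Enat k z : wunit A k (wact A k z) = stf Tv k (la k z).
  have E : graph_comp (wunit A) (wact A) = graph_comp (stf Tv) la :=
    adj_unit_nat adj (alg_act A).
  by rewrite -[LHS]/(gfun (graph_comp (wunit A) (wact A)) z) E.
have Etri k z : stf mu k (la k z) = z.
  have E : graph_comp (stf mu) la = graph_id (wfree A) :=
    adj_triangleU adj (F (wgraph A)).
  by rewrite -[LHS]/(gfun (graph_comp (stf mu) la) z) E.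
have E := hom_composable la e.
rewrite /wcomp; transitivity (wact A m (stf mu m (comp h (la m y) (la m x) E))).
  rewrite (mfun_comp E (hom_composable (stf mu) E)).
  by congr (wact A m _); apply: comp_congr; rewrite Etri.
rewrite Emu (mfun_comp E (hom_composable (stf Tv) E)).
by congr (wact A m _); apply: comp_congr; rewrite Enat.
Qed.

(** The image of the contraction of [x] and [y] is a cell of [G] from [v y] to
    [v x]; an identity cell has equal ends. *)
Lemma wact_eq {m} (x y : wfree A m) :
  (forall c : wgraph A m.+1, is_identity (wreflexors A) c) ->
  parallel x y -> stpi (F (wgraph A)) m x = stpi (F (wgraph A)) m y ->
  wact A m x = wact A m y.
Proof.
move=> idG par e; have [c Ec] := idG (wact A m.+1 (br (F (wgraph A)) x y par e)).
rewrite -(tgt_br par e) -[in RHS](src_br par e).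
by rewrite gfun_tgt gfun_src Ec src_rfl tgt_rfl.
Qed.

(** With identity 3-cells only, the contraction of a pair of 1-cells acts as an
    isomorphism; its inverse is the contraction of the pair reversed. *)
Lemma iso21_br (x y : wfree A 1) par e :
  (forall c : wgraph A 3, is_identity (wreflexors A) c) ->
  iso21 (wact A 2 (br (F (wgraph A)) x y par e)).
Proof.
move=> idG.
have half (x' y' : wfree A 1) par' e' par'' e'' E :
    wcomp (below_S) (wact A 2 (br (F (wgraph A)) x' y' par' e'))
      (wact A 2 (br (F (wgraph A)) y' x' par'' e'')) E =
    wid below_S (wact A 1 x').
  have E0 : isrc below_S (br (F (wgraph A)) x' y' par' e') =
      itgt below_S (br (F (wgraph A)) y' x' par'' e'').
    by rewrite /= src_br tgt_br.
  rewrite -(wact_comp E0) -[RHS]/(rfl (wreflexors A) _) -wact_rfl.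
  apply: wact_eq => //; last by rewrite stpi_comp_br mfun_rfl.
  have srcE := isrc_comp_le below_S E0 (leqnn 1).
  have tgtE := itgt_comp_le below_S E0 (leqnn 1).
  by split; rewrite ?src_rfl ?tgt_rfl; [rewrite [LHS]srcE /= src_br |
    rewrite [LHS]tgtE /= tgt_br].
have par' : parallel y x by case: par.
exists (wact A 2 (br (F (wgraph A)) y x par' (esym e))).
have E1 : src (wact A 2 (br (F (wgraph A)) x y par e)) =
    tgt (wact A 2 (br (F (wgraph A)) y x par' (esym e))).
  by rewrite -gfun_src -gfun_tgt src_br tgt_br.
have E2 : src (wact A 2 (br (F (wgraph A)) y x par' (esym e))) =
    tgt (wact A 2 (br (F (wgraph A)) x y par e)).
  by rewrite -gfun_src -gfun_tgt src_br tgt_br.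
exists E1, E2; rewrite !half -gfun_src -gfun_tgt src_br tgt_br.
by split.
Qed.

(** Such an [x] is parallel to the formal identity of its end [c] and has the
    same image in the strict part, so the two can be contracted.  It is applied
    to the composites of a generator and its formal reversal, in both orders. *)
Lemma iso21_wid (c : wgraph A 0) (x : wfree A 1) :
  (forall c : wgraph A 3, is_identity (wreflexors A) c) ->
  src x = wunit A 0 c -> tgt x = wunit A 0 c ->
  stpi (F (wgraph A)) 1 x =
    rfl (mrfl (stC (F (wgraph A)))) (stpi (F (wgraph A)) 0 (wunit A 0 c)) ->
  exists alpha : wgraph A 2,
    [/\ src alpha = wact A 1 x, tgt alpha = wid below_S c & iso21 alpha].
Proof.
move=> idG sx tx pix.
have par : parallel (rfl (mrfl (wfree A)) (wunit A 0 c)) x.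
  by split; rewrite ?src_rfl ?tgt_rfl.
have e : stpi (F (wgraph A)) 1 (rfl (mrfl (wfree A)) (wunit A 0 c)) =
    stpi (F (wgraph A)) 1 x by rewrite pix mfun_rfl.
exists (wact A 2 (br (F (wgraph A)) _ _ par e)).
by split; [rewrite -gfun_src src_br | rewrite -gfun_tgt tgt_br | apply: iso21_br].
Qed.

End Algebra.

Theorem proposition2 (F : functor Gr (EtCat 0)) (adj : adjunction F (forget 0))
  (A : weak_ncat adj) (dimA : wdimension A 2)
  (a b : wgraph A 0) (f : wgraph A 1) (sf : src f = a) (tf : tgt f = b) :
  is_equivalence a b f.
Proof.
have idG (c : wgraph A 3) : is_identity (wreflexors A) c by apply: dimA.1.
pose u := wunit A 1 f; pose j := rev (nrev (wfree A)) (leqnn 0) below_S u.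
have su : src u = wunit A 0 a by rewrite -gfun_src sf.
have tu : tgt u = wunit A 0 b by rewrite -gfun_tgt tf.
have sj : src j = tgt u by apply: src_rev_top.
have tj : tgt j = src u by apply: tgt_rev_top.
have Eju : isrc below_S j = itgt below_S u by [].
have Euj : isrc below_S u = itgt below_S j by [].
have vu : wact A 1 u = f by apply: wact_unit.
have [piju piuj] := stpi_comp_rev (leqnn 0) below_S u.
have [alpha [sa ta ia]] := @iso21_wid _ _ _ A a (comp below_S j u Eju) idG
  (etrans (isrc_comp_le below_S Eju (leqnn 0)) su)
  (etrans (itgt_comp_le below_S Eju (leqnn 0)) (etrans tj su))
  ltac:(by rewrite (piju Eju) /= -gfun_src su).
have [beta [sb tb ib]] := @iso21_wid _ _ _ A b (comp below_S u j Euj) idG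
  (etrans (isrc_comp_le below_S Euj (leqnn 0)) (etrans sj tu))
  (etrans (itgt_comp_le below_S Euj (leqnn 0)) tu)
  ltac:(by rewrite (piuj Euj) /= -gfun_tgt tu).
split=> //; split=> //; exists (wact A 1 j).
split; first by rewrite -gfun_src sj tu wact_unit.
split; first by rewrite -gfun_tgt tj su wact_unit.
rewrite -vu.
exists (hom_composable (wact A) Eju), (hom_composable (wact A) Euj), alpha, beta.
by rewrite sa sb; split; split=> //; apply: wact_comp.
Qed.
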